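(* Let $m,n$ be positive integers and let $f$ be a probability density function on $\mathbb R$ (the pdf of the additive noise). Then the following family of lower bounds, indexed by the real parameter $\gamma$, holds: $$C(m,n,f)\;\ge\; n-m\gamma\, h(f)-\log_2\left(\sum_{k=0}^{n}\binom nk\left(\sum_{j=0}^{k}\frac{\binom kj}{2^k}\,g_\gamma\!\left(\frac{4j-2k}{\sqrt m}\right)\right)^m\right),$$ where $h(f)=-\int f(x)\log_2 f(x)\,dx$ is the differential entropy of $f$ and the function $g_\gamma$ is defined by $g_\gamma(t)=\int f(t+x)f(x)^\gamma\,dx$.
   Context: Let $\mathcal M_{m\times n}(\pm1)$ be the set of $m\times n$ matrices with entries in $\{+1,-1\}$. For $A\in\mathcal M_{m\times n}(\pm1)$ and a pdf $f$ on $\mathbb R$, the noisy binary CDMA channel has input $X=(X_1,\dots,X_n)^T\in\{\pm1\}^n$ and output $Y=\frac1{\sqrt m}AX+N$, where $N=(N_1,\dots,N_m)^T$ is an additive noise vector with i.i.d. entries with density $f$, independent of $X$. Its sum capacity is $C(A,f)=\max I(X;Y)$, where $I$ is mutual information in bits (base-2 logarithms) and the maximum is over all product distributions of $X$ on $\{\pm1\}^n$ (i.e. $X_1,\dots,X_n$ independent). Define $C(m,n,f)=\max_{A\in\mathcal M_{m\times n}(\pm1)}C(A,f)$. The family arises by taking $q(x)=-\gamma\log_2 f(x)$ in the lower bound $C(m,n,f)\ge n-m\,\mathbb E(q(N_1))-\log_2\Big(\sum_{k=0}^n\binom nk\big(\mathbb E(2^{-q(N_1-2S_k/\sqrt m)})\big)^m\Big)$,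 stated for any function $q$, where $S_k$ is a sum of $k$ independent random variables taking $\pm1$ with equal probability, independent of $N_1$. *)

(* Defs.v *)
From HB Require Import structures.
From mathcomp Require Import all_boot all_order all_algebra.
From mathcomp Require Import all_classical all_reals all_analysis.

Set Implicit Arguments.
Unset Strict Implicit.
Unset Printing Implicit Defensive.

Import Order.TTheory GRing.Theory Num.Theory.
Import numFieldNormedType.Exports.

Local Open Scope classical_set_scope.
Local Open Scope ring_scope.

Definition log2 (R : realType) (x : R) : R := ln x / ln 2.

Definition log2e (R : realType) (x : \bar R) : \bar R :=
  (((ln 2)^-1)%:E * lne x)%E.

Section Independence.
Context d (T : measurableType d) (R : realType) (P : probability T R).

Definition mutually_independent (I : finType) d' (E : measurableType d')
    (Z : I -> T -> E) : Prop :=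
  forall (J : {set I}) (B : I -> set E), (forall i, measurable (B i)) ->
    P (\bigcap_(i in [set` J]) (Z i @^-1` B i)) =
    (\prod_(i in J) P (Z i @^-1` B i))%E.

Definition independent_pair d1 d2 (E1 : measurableType d1)
    (E2 : measurableType d2) (X : T -> E1) (Y : T -> E2) : Prop :=
  forall A B, measurable A -> measurable B ->
    P (X @^-1` A `&` Y @^-1` B) = (P (X @^-1` A) * P (Y @^-1` B))%E.

End Independence.

Section MutualInformation.
Context d (T : measurableType d) (R : realType).

(* Kullback-Leibler divergence in bits. *)
Definition kl_divergence (P Q : probability T R) : \bar R :=
  if `[< P `<< Q >] then
    (\int[P]_x log2e (Radon_Nikodym (charge_of_finite_measure P) Q x))%E
  else +oo%E.

End MutualInformation.

Section RVPair.
Context d d1 d2 (T : measurableType d) (E1 : measurableType d1)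
  (E2 : measurableType d2) (X : {mfun T >-> E1}) (Y : {mfun T >-> E2}).

Definition rv_pair (w : T) : E1 * E2 := (X w, Y w).

Let measurable_rv_pair : measurable_fun [set: T] rv_pair.
Proof. by apply: measurable_fun_pair; exact: measurable_funPT. Qed.

HB.instance Definition _ :=
  @isMeasurableFun.Build _ _ T (E1 * E2)%type rv_pair measurable_rv_pair.

End RVPair.
Definition mutual_information d d1 d2 (T : measurableType d)
    (E1 : measurableType d1) (E2 : measurableType d2) (R : realType)
    (P : probability T R) (X : {RV P >-> E1}) (Y : {RV P >-> E2}) : \bar R :=
  kl_divergence (distribution P (rv_pair X Y))
    (distribution P X \x distribution P Y)%E.

Section Density.
Context (R : realType).
Local Notation mu := (@lebesgue_measure R).

Definition is_pdf (f : R -> R) : Prop :=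
  [/\ measurable_fun [set: R] f, forall x, 0 <= f x
    & (\int[mu]_x (f x)%:E = 1)%E].

Definition has_density d (T : measurableType d) (P : probability T R)
    (Z : T -> R) (f : R -> R) : Prop :=
  forall B : set R, measurable B ->
    P (Z @^-1` B) = (\int[mu]_(x in B) (f x)%:E)%E.

(* [ln 0 = 0], so the integrand vanishes wherever [f] does; the integral is
   extended-real valued, as an arbitrary density may have infinite entropy. *)
Definition diff_entropy (f : R -> R) : \bar R :=
  (- \int[mu]_x (f x * log2 (f x))%:E)%E.

(* [powR] sets [0 `^ gamma = 0] for [gamma < 0] (and [0 `^ 0 = 1]): for a
   negative exponent only the points where [f x > 0] contribute. *)
Definition g_fun (f : R -> R) (gamma t : R) : \bar R :=
  (\int[mu]_x (f (t + x) * f x `^ gamma)%:E)%E.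

End Density.

Section CDMA.
Context (R : realType) (m n : nat).
Implicit Types (A : 'M[R]_(m, n)) (f : R -> R).

Definition pm1 (x : R) : Prop := x = 1 \/ x = -1.

Definition pm1_matrix : set 'M[R]_(m, n) := [set A | forall i j, pm1 (A i j)].

Definition cdma_output A (x : n.-tuple R) (z : m.-tuple R) : m.-tuple R :=
  [tuple ((Num.sqrt m%:R)^-1 *: (A *m \col_j tnth x j)) i 0 + tnth z i
  | i < m].

Definition cdma_channel A f d (T : measurableType d) (P : probability T R)
    (X : {RV P >-> n.-tuple R}) (N Y : {RV P >-> m.-tuple R}) : Prop :=
  [/\ forall w j, pm1 (tnth (X w) j),
      forall i, has_density P (fun w => tnth (N w) i) f,
      mutually_independent P (fun i w => tnth (N w) i),
      independent_pair P X N
    & forall w, Y w = cdma_output A (X w) (N w)].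

(* The set of values of I(X;Y), over all laws of X with independent
   components, realised on arbitrary probability spaces. *)
Definition achievable_information A f : set (\bar R) :=
  [set I | exists d (T : measurableType d) (P : probability T R)
             (X : {RV P >-> n.-tuple R}) (N Y : {RV P >-> m.-tuple R}),
     [/\ cdma_channel A f X N Y,
         mutually_independent P (fun j w => tnth (X w) j)
       & I = mutual_information X Y]].

(* I(X;Y) is a continuous function of the marginals of X, which range over a
   compact set, and there are finitely many matrices: both suprema are maxima. *)
Definition sum_capacity A f : \bar R := ereal_sup (achievable_information A f).

Definition cdma_capacity f : \bar R :=
  ereal_sup [set sum_capacity A f | A in pm1_matrix].

End CDMA.

(* Main.v *)
(* Take X uniform on {-1,1}^n.  For any weight w >= 0 with w(N) > 0 almost
   surely, Gibbs' inequality applied to the posterior that w(y - A x / sqrt m)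
   induces on x gives
     I(X;Y) >= E log w(N) - E log D(Y),
   where D(y) is the mean of w(y - A x / sqrt m) over x.  By concavity of log,
   E log D(Y) <= log E D(Y), and for w(z) = prod_i f(z_i)^gamma the expectation
   E D(Y) is a mean, over pairs of inputs (x, x'), of products over the rows of A
   of values of g_gamma at the coordinates of A (x' - x) / sqrt m.  Averaged over
   all sign matrices A it becomes 2^-n times the sum in the statement, so some A
   does at least as well as the average.  If that sum is infinite, or if
   gamma f log f is not integrable, the left-hand side is -oo. *)
Require Import Defs.
From HB Require Import structures.
From mathcomp Require Import all_boot all_order all_algebra.
From mathcomp Require Import all_classical all_reals all_analysis.
From mathcomp Require Import measurable_realfun.
From mathcomp Require Import ring lra.

Set Implicit Arguments.
Unset Strict Implicit.
Unset Printing Implicit Defensive.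

Import Order.TTheory GRing.Theory Num.Theory.
Import numFieldNormedType.Exports.

Local Open Scope ring_scope.

(** No density of the joint law is ever computed: [kl_divergence_ge] needs only a weight [u] of mean
    at most 1 under the product of the marginals, and if the joint law is not dominated by that
    product the divergence is [+oo] anyway. The remaining obstacle is an infinite entropy. The
    [k = 0] term of the sum is [g_gamma(0) ^ m], where [g_gamma(0)] is the integral of
    [f * f ^ gamma]. Since [gamma ln f < f ^ gamma] wherever [f > 0], a finite sum bounds the
    positive part of [gamma f ln f], whose integral is then finite or [-oo], never [+oo]. A finite
    sum also makes every value of [g_gamma] that occurs finite, so the averaging over matrices takes
    place in a field. *)

(** * Counting over sign vectors and sign matrices *)

Section Combinatorics.
Context (R : numFieldType).

Lemma sum_subset_card (I : finType) (D : {set I}) (H : nat -> R) :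
  \sum_(K : {set I} | K \subset D) H #|K| =
  \sum_(0 <= j < #|D|.+1) 'C(#|D|, j)%:R * H j.
Proof.
rewrite big_mkord.
rewrite (partition_big (fun K : {set I} => inord #|K| : 'I_#|D|.+1) xpredT) //=.
apply: eq_bigr => j _.
rewrite (eq_bigl (fun K : {set I} => (K \subset D) && (#|K| == j))).
  rewrite (eq_bigr (fun=> H j)); last by move=> K /andP[_ /eqP ->].
  rewrite sumr_const -[LHS]mulr_natl; congr (_%:R * _).
  by rewrite -(cards_draws D j) cardsE.
move=> K; case: (boolP (K \subset D)) => //= KD.
by rewrite -val_eqE /= inordK // ltnS subset_leq_card.
Qed.

(** Each trace [K] on [D] is realised by the [2 ^ (n - #|D|)] sets [K :|: L] with [L] outside [D].
    In other words, the size of the trace of a uniform random set is binomial. *)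
Lemma sum_cardI (n : nat) (D : {set 'I_n}) (H : nat -> R) :
  \sum_(J : {set 'I_n}) H #|J :&: D| =
  2 ^+ n * \sum_(0 <= j < #|D|.+1) 'C(#|D|, j)%:R / 2 ^+ #|D| * H j.
Proof.
rewrite (partition_big (fun J : {set 'I_n} => J :&: D)
  (fun K : {set 'I_n} => K \subset D)) /=; last by move=> J _; exact: finset.subsetIr.
have fiber (K : {set 'I_n}) : K \subset D ->
    \sum_(J : {set 'I_n} | J :&: D == K) H #|J :&: D| =
    2 ^+ n / 2 ^+ #|D| * H #|K|.
  move=> KD.
  rewrite (eq_bigr (fun=> H #|K|)); last by move=> J /eqP ->.
  rewrite (reindex_onto (fun L => K :|: L) (fun J => J :\: D)); last first.
    by move=> J /eqP <-; rewrite finset.setID.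
  rewrite (eq_bigl (fun L => L \in powerset (~: D))); last first.
    move=> L; rewrite powersetE; apply/andP/idP => [[_ /eqP <-]|LD].
      by rewrite finset.setDE finset.subsetIr.
    have LD0 : L :&: D = finset.set0.
      by apply/eqP; rewrite finset.setI_eq0 finset.disjoints_subset.
    split; first by rewrite finset.setIUl LD0 finset.setU0 (finset.setIidPl KD).
    rewrite finset.setDUl; have /eqP -> : K :\: D == finset.set0 by rewrite finset.setD_eq0.
    by rewrite finset.set0U finset.setDE; exact/eqP/finset.setIidPl.
  rewrite sumr_const card_powerset [#|~: D|]cardsCs finset.setCK card_ord.
  rewrite -[LHS]mulr_natl natrX; congr (_ * _).
  have DN : (#|D| <= n)%N by rewrite -[leqRHS]card_ord max_card.
  by rewrite -[X in _ = 2 ^+ X / _](subnK DN) exprD mulfK // expf_neq0 // pnatr_eq0.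
rewrite (eq_bigr _ fiber) -big_distrr /= sum_subset_card.
rewrite -mulrA big_distrr /=; congr (_ * _); apply: eq_bigr => j _.
by rewrite mulrCA mulrA.
Qed.

Definition sgn_bool (b : bool) : R := (-1) ^+ b.

(** [J] collects the positions where [a] and [b] have the same sign. Positions outside [D]
    contribute 0; a position of [D] contributes 2 if it lies in [J] and -2 otherwise. *)
Lemma signed_rowE (n : nat) (b c : n.-tuple bool) (a : 'I_n -> bool)
    (D := [set j | tnth b j != tnth c j])
    (J := [set j | a j (+) ~~ tnth b j]) :
  \sum_j sgn_bool (a j) * (sgn_bool (tnth b j) - sgn_bool (tnth c j)) =
  4 * #|J :&: D|%:R - 2 * #|D|%:R.
Proof.
rewrite -sum1_card natr_sum -sum1_card natr_sum !big_distrr /=.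
rewrite (big_mkcond (mem (J :&: D))) (big_mkcond (mem D)) /= -sumrB.
apply: eq_bigr => j _; rewrite !inE /sgn_bool.
by case: (a j); case: (tnth b j); case: (tnth c j) => /=;
  rewrite ?expr0 ?expr1; ring.
Qed.

(** For fixed [b], the row [a] and its agreement set [J] determine each other, so a uniform row
    amounts to a uniform set [J]. This is where the values [4j - 2k] come from. *)
Lemma sum_signed_row (n : nat) (b c : n.-tuple bool) (H : R -> R)
    (k := #|[set j | tnth b j != tnth c j]|) :
  \sum_(a : {ffun 'I_n -> bool})
    H (\sum_j sgn_bool (a j) * (sgn_bool (tnth b j) - sgn_bool (tnth c j))) =
  2 ^+ n * \sum_(0 <= j < k.+1) 'C(k, j)%:R / 2 ^+ k * H (4 * j%:R - 2 * k%:R).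
Proof.
set D := [set j | tnth b j != tnth c j].
rewrite -(sum_cardI D (fun j => H (4 * j%:R - 2 * k%:R))).
rewrite (reindex (fun J : {set 'I_n} => [ffun j => (j \in J) (+) ~~ tnth b j])) /=; last first.
  exists (fun a : {ffun 'I_n -> bool} => [set j | a j (+) ~~ tnth b j]).
    by move=> J _; apply/setP => j; rewrite inE ffunE -addbA addbb addbF.
  by move=> a _; apply/ffunP => j; rewrite ffunE inE -addbA addbb addbF.
apply: eq_bigr => J _; rewrite signed_rowE -/D; congr (H (4 * #|pred_of_set (_ :&: D)|%:R - _)).
by apply/setP => j; rewrite inE ffunE -addbA addbb addbF.
Qed.

(** A word [c] is determined by [b] and the set of positions where the two differ, so words are
    counted by Hamming distance. *)
Lemma sum_tuple_neq (n : nat) (b : n.-tuple bool) (K : nat -> R) :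
  \sum_(c : n.-tuple bool) K #|[set j | tnth b j != tnth c j]| =
  \sum_(0 <= k < n.+1) 'C(n, k)%:R * K k.
Proof.
have := sum_subset_card [set: 'I_n] K; rewrite finset.cardsT card_ord => <-.
rewrite (reindex (fun J : {set 'I_n} => [tuple tnth b j (+) (j \in J) | j < n])) /=; last first.
  exists (fun c : n.-tuple bool => [set j | tnth b j (+) tnth c j]).
    by move=> J _; apply/setP => j; rewrite inE tnth_mktuple addbA addbb.
  by move=> c _; apply/eq_from_tnth => j; rewrite tnth_mktuple inE addbA addbb.
apply: eq_big => [J|J _]; first by rewrite finset.subsetT.
congr (K #|pred_of_set _|); apply/setP => j; rewrite inE tnth_mktuple.
by case: (tnth b j); case: (j \in J).
Qed.

Definition sgn_matrix (m n : nat) (a : {ffun 'I_m -> {ffun 'I_n -> bool}}) :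
  'M[R]_(m, n) := \matrix_(i, j) sgn_bool (a i j).

(** Rows are chosen independently, so for fixed [b] and [c] the sum over matrices of a product over
    rows is the [m]-th power of the sum over one row. That power depends on the pair only through
    its Hamming distance. *)
Lemma sum_signed_matrix (m n : nat) (H : R -> R) :
  \sum_(a : {ffun 'I_m -> {ffun 'I_n -> bool}})
    \sum_(b : n.-tuple bool) \sum_(c : n.-tuple bool)
     \prod_i H (\sum_j sgn_matrix a i j * (sgn_bool (tnth b j) - sgn_bool (tnth c j))) =
  (2 ^+ n) ^+ m * 2 ^+ n *
   \sum_(0 <= k < n.+1) 'C(n, k)%:R *
     (\sum_(0 <= j < k.+1) 'C(k, j)%:R / 2 ^+ k * H (4 * j%:R - 2 * k%:R)) ^+ m.
Proof.
pose K k := (\sum_(0 <= j < k.+1) 'C(k, j)%:R / 2 ^+ k * H (4 * j%:R - 2 * k%:R)) ^+ m.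
rewrite -/(\sum_(0 <= k < n.+1) 'C(n, k)%:R * K k).
set S := \sum_(0 <= k < n.+1) _.
rewrite exchange_big /=.
rewrite (eq_bigr (fun=> (2 ^+ n) ^+ m * S)); last first.
  move=> b _; rewrite exchange_big /=.
  rewrite (eq_bigr (fun c => (2 ^+ n) ^+ m * K #|[set j | tnth b j != tnth c j]|)).
    by rewrite -big_distrr /= (sum_tuple_neq b K).
  move=> c _ /=; rewrite /K -exprMn -sum_signed_row.
  transitivity (\prod_(i < m) \sum_(r : {ffun 'I_n -> bool})
    H (\sum_j sgn_bool (r j) * (sgn_bool (tnth b j) - sgn_bool (tnth c j)))).
    rewrite bigA_distr_bigA /=; apply: eq_bigr => a _; apply: eq_bigr => i _.
    by congr H; apply: eq_bigr => j _; rewrite mxE.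
  by rewrite prodr_const card_ord.
by rewrite sumr_const card_tuple card_bool -[LHS]mulr_natl natrX mulrA [2 ^+ n * _]mulrC.
Qed.

End Combinatorics.

(** Some value is at most the average; there are [(2 ^+ n) ^+ m] sign matrices, which cancels that
    factor of [sum_signed_matrix]. *)
Lemma exists_signed_matrix (R : realFieldType) (m n : nat) (H : R -> R) :
  exists a : {ffun 'I_m -> {ffun 'I_n -> bool}},
    \sum_(b : n.-tuple bool) \sum_(c : n.-tuple bool)
     \prod_i H (\sum_j sgn_matrix R a i j * (sgn_bool R (tnth b j) - sgn_bool R (tnth c j))) <=
   2 ^+ n * \sum_(0 <= k < n.+1) 'C(n, k)%:R *
     (\sum_(0 <= j < k.+1) 'C(k, j)%:R / 2 ^+ k * H (4 * j%:R - 2 * k%:R)) ^+ m.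
Proof.
pose F (a : {ffun 'I_m -> {ffun 'I_n -> bool}}) :=
  \sum_(b : n.-tuple bool) \sum_(c : n.-tuple bool) \prod_i
    H (\sum_j sgn_matrix R a i j * (sgn_bool R (tnth b j) - sgn_bool R (tnth c j))).
set S := 2 ^+ n * _.
have sumF : \sum_a F a = \sum_(a : {ffun 'I_m -> {ffun 'I_n -> bool}}) S.
  rewrite /F sum_signed_matrix sumr_const !card_ffun !card_ord card_bool.
  by rewrite -[RHS]mulr_natl !natrX mulrA.
case: (boolP [exists a, F a <= S]) => [/existsP //|/existsPn noa].
have : \sum_(a : {ffun 'I_m -> {ffun 'I_n -> bool}}) S < \sum_a F a.
  apply: ltr_sum => [|a _]; last by rewrite ltNge noa.
  by apply/hasP; exists [ffun=> [ffun=> true]]; rewrite ?mem_index_enum.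
by rewrite sumF ltxx.
Qed.

Local Open Scope classical_set_scope.
Local Open Scope ring_scope.

(** * Laws of vectors with i.i.d. coordinates *)

Lemma emeasurable_prod d (T : measurableType d) (R : realType) (D : set T)
    (I : Type) (s : seq I) (F : I -> T -> \bar R) :
  (forall i, measurable_fun D (F i)) ->
  measurable_fun D (fun x => \prod_(i <- s) F i x)%E.
Proof.
move=> mF; elim: s => [|i s IH].
  by under eq_fun do rewrite big_nil; exact: measurable_cst.
by under eq_fun do rewrite big_cons; exact: emeasurable_funM.
Qed.

Section PowerProbability.
Context d (T : measurableType d) (R : realType).

Definition tuple_cons n (x : T * n.-tuple T) : n.+1.-tuple T :=
  [tuple of x.1 :: x.2].

Fact measurable_tuple_cons n : measurable_fun [set: T * n.-tuple T] (@tuple_cons n).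
Proof. by apply: measurable_cons. Qed.

HB.instance Definition _ n :=
  @isMeasurableFun.Build _ _ _ _ (@tuple_cons n) (@measurable_tuple_cons n).

(** The i.i.d. law is built one coordinate at a time, so that Tonelli peels off the head in
    inductions on [n]. *)
Fixpoint power_probability (p : probability T R) n : probability (n.-tuple T) R :=
  match n with
  | 0 => \d_([tuple] : 0.-tuple T)
  | n.+1 => distribution (p \x power_probability p n)%E (@tuple_cons n)
  end.

Variable p : probability T R.

Lemma ge0_integral_power_probabilityS n (F : n.+1.-tuple T -> \bar R) :
  measurable_fun [set: _] F -> (forall t, 0 <= F t)%E ->
  (\int[power_probability p n.+1]_t F t =
   \int[p]_x \int[power_probability p n]_t F (tuple_cons (x, t)))%E.
Proof.
move=> mF F0.
rewrite /power_probability -/power_probability ge0_integral_distribution //.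
rewrite fubini_tonelli1 //=; last by apply: measurableT_comp.
Qed.

Lemma ge0_integral_power_probability_prod n (F : 'I_n -> T -> \bar R) :
  (forall i, measurable_fun [set: _] (F i)) -> (forall i x, 0 <= F i x)%E ->
  (\int[power_probability p n]_t \prod_i F i (tnth t i) =
   \prod_i \int[p]_x F i x)%E.
Proof.
elim: n F => [|n IH] F mF F0.
  under eq_integral do rewrite big_ord0.
  by rewrite integral_cst //= ?diracT ?big_ord0 ?mul1e.
rewrite ge0_integral_power_probabilityS; last 2 first.
- apply: emeasurable_prod => i; apply: measurableT_comp => //.
  exact: measurable_tnth.
- by move=> t; apply: prode_ge0.
rewrite big_ord_recl -IH //.
rewrite -ge0_integralZr //; last first.
- by apply: integral_ge0 => t _; apply: prode_ge0.
apply: eq_integral => x _.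
rewrite -ge0_integralZl //; last 2 first.
- by apply: emeasurable_prod => i; apply: measurableT_comp => //; exact: measurable_tnth.
- by move=> t _; apply: prode_ge0.
apply: eq_integral => t _.
by rewrite big_ord_recl; congr (_ * _)%E; apply: eq_bigr => i _; rewrite tnthS.
Qed.

Lemma ge0_integral_power_probability_tnth n (i : 'I_n) (F : T -> \bar R) :
  measurable_fun [set: T] F -> (forall x, 0 <= F x)%E ->
  (\int[power_probability p n]_t F (tnth t i) = \int[p]_x F x)%E.
Proof.
move=> mF F0; pose G j := if j == i then F else cst 1%E.
have mG j : measurable_fun [set: T] (G j).
  by rewrite /G; case: ifP => _ //; exact: measurable_cst.
have G0 j x : (0 <= G j x)%E by rewrite /G; case: ifP.
transitivity (\int[power_probability p n]_t \prod_j G j (tnth t j))%E.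
  apply: eq_integral => t _; rewrite (bigD1 i)//= big1 ?mule1 /G ?eqxx//.
  by move=> j /negbTE ->.
rewrite ge0_integral_power_probability_prod// (bigD1 i)//= big1 ?mule1 /G ?eqxx//.
by move=> j /negbTE ->; rewrite integral_cst// mul1e; exact: probability_setT.
Qed.

Lemma integral_indic_preimage d1 d2 (T1 : measurableType d1) (T2 : measurableType d2)
    (mu : {measure set T1 -> \bar R}) (Z : T1 -> T2) (B : set T2) :
  measurable_fun [set: T1] Z -> measurable B ->
  mu (Z @^-1` B) = (\int[mu]_w (\1_B (Z w))%:E)%E.
Proof.
move=> mZ mB; rewrite -[in LHS](setIT (Z @^-1` B)) -integral_indic//.
by rewrite -[X in measurable X]setTI; exact: mZ.
Qed.

Lemma power_probability_tnth n (i : 'I_n) (B : set T) : measurable B ->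
  power_probability p n ((fun t => tnth t i) @^-1` B) = p B.
Proof.
move=> mB; rewrite integral_indic_preimage //; last exact: measurable_tnth.
rewrite (ge0_integral_power_probability_tnth i (F := fun x => (\1_B x)%:E)) //.
- by rewrite integral_indic// setIT.
- exact/measurable_EFinP.
Qed.

(** With the whole space put at the indices outside [J], the indicator of the intersection is a
    product over all coordinates, to which the product formula for integrals applies. *)
Lemma power_probability_bigcap n (J : {set 'I_n}) (B : 'I_n -> set T) :
  (forall i, measurable (B i)) ->
  power_probability p n (\bigcap_(i in [set` J]) ((fun t => tnth t i) @^-1` B i)) =
  (\prod_(i in J) p (B i))%E.
Proof.
move=> mB; pose C i := if i \in J then B i else [set: T].
have mC i : measurable (C i) by rewrite /C; case: ifP.
set E := \bigcap_(i in _) _.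
have mE : measurable E.
  apply: fin_bigcap_measurable => // i _.
  by rewrite -[X in measurable X]setTI; exact: measurable_tnth.
rewrite -[in LHS](setIT E) -integral_indic//.
transitivity (\int[power_probability p n]_t \prod_i (\1_(C i) (tnth t i))%:E)%E.
  apply: eq_integral => t _; rewrite indicE.
  have [tE|tE] := boolP (t \in E).
    rewrite big1// => i _; rewrite indicE mem_set// /C.
    by case: ifPn => // iJ; move: tE; rewrite inE => /(_ i iJ).
  have [i iJ nB] : exists2 i, i \in J & ~ B i (tnth t i).
    apply/not_exists2P => allB; move: tE; rewrite notin_setE; apply => i /= iJ.
    by have [//|] := allB i => /contrapT.
  by rewrite (bigD1 i)//= indicE memNset ?mul0e// /C iJ.
rewrite (ge0_integral_power_probability_prod (F := fun i x => (\1_(C i) x)%:E)).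
- rewrite [RHS]big_mkcond; apply: eq_bigr => i _.
  rewrite integral_indic// setIT /C; case: ifP => // _; exact: probability_setT.
- by move=> i; apply/measurable_EFinP.
- by move=> i x; rewrite lee_fin.
Qed.

End PowerProbability.

Lemma ge0_integral_power_bernoulli (R : realType) n (F : n.-tuple bool -> R) :
  measurable_fun [set: _] F -> (forall b, 0 <= F b) ->
  (\int[power_probability (bernoulli_prob 2^-1) n]_b (F b)%:E =
   ((2 ^+ n)^-1 * \sum_b F b)%:E :> \bar R)%E.
Proof.
elim: n F => [|n IH] F mF F0.
  rewrite integral_dirac//= ?diracT; last exact/measurable_EFinP.
  rewrite mul1e expr0 invr1 mul1r; congr (_%:E).
  by rewrite (big_pred1 [tuple])// => b; rewrite [b]tuple0; apply/esym/eqP.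
rewrite ge0_integral_power_probabilityS => [||b]; last 2 first.
- exact/measurable_EFinP.
- by rewrite lee_fin.
have mFc c : measurable_fun [set: n.-tuple bool] (fun b => F (tuple_cons (c, b))).
  apply: (measurableT_comp mF).
  exact: (@measurable_cons _ _ _ _ (cst c) n id).
under eq_integral => c _ do rewrite IH//.
rewrite integral_bernoulli_prob.
- rewrite -!EFinM -EFinD; congr (_%:E).
  have -> : unstable.onem (2^-1 : R) = 2^-1 by rewrite /unstable.onem; lra.
  rewrite -!mulrDr exprS invfM -mulrA; congr (_ * (_ * _)).
  rewrite (reindex (fun x : bool * n.-tuple bool => tuple_cons x)) /=; last first.
    exists (fun t : n.+1.-tuple bool => (thead t, [tuple of behead t])).
      by move=> [c b] _; rewrite /tuple_cons theadE; congr pair; apply/val_inj.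
    by move=> t _; rewrite [RHS]tuple_eta /tuple_cons; apply/val_inj.
  by rewrite -(pair_big xpredT xpredT (fun (c : bool) (b : n.-tuple bool) =>
    F (tuple_cons (c, b)))) big_bool.
- by apply/andP; split; lra.
- by move=> c; rewrite lee_fin mulr_ge0// ?invr_ge0 ?exprn_ge0// sumr_ge0.
Qed.

(** * The probability measure with a given density *)

Section DensityProbability.
Context (R : realType) (f : R -> R) (pdf_f : is_pdf f).
Local Notation mu := (@lebesgue_measure R).

(** The proof of [is_pdf f] is an argument so that the measure and probability structures below can
    be attached to the term itself. *)
Definition pdf_measure of is_pdf f : set _ -> \bar R :=
  fun B => (\int[mu]_(x in B) (f x)%:E)%E.

Local Notation P := (pdf_measure pdf_f).

Let f_ge0 x : 0 <= f x. Proof. by case: pdf_f. Qed.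
Let measurable_f : measurable_fun [set: R] f. Proof. by case: pdf_f. Qed.

Let pdf_measure0 : P set0 = 0%E.
Proof. by rewrite /pdf_measure integral_set0. Qed.

Let pdf_measure_ge0 B : (0 <= P B)%E.
Proof. by apply: integral_ge0 => x _; rewrite lee_fin. Qed.

Let pdf_measure_sigma_additive : semi_sigma_additive P.
Proof.
move=> /= F mF tF mUF; rewrite /pdf_measure; apply: cvg_toP.
  apply: ereal_nondecreasing_is_cvgn => m n mn.
  apply: lee_sum_nneg_natr => // k _ _.
  by apply: integral_ge0 => x _; rewrite lee_fin.
rewrite ge0_integral_bigcup//=; last by move=> x _; rewrite lee_fin.
by apply: measurable_funTS; exact/measurable_EFinP.
Qed.

HB.instance Definition _ := isMeasure.Build _ _ _ P
  pdf_measure0 pdf_measure_ge0 pdf_measure_sigma_additive.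

Let pdf_measure_setT : P [set: R] = 1%E.
Proof. by case: pdf_f. Qed.

HB.instance Definition _ := @Measure_isProbability.Build _ _ R P pdf_measure_setT.

Lemma pdf_measure_dominates : P `<< mu.
Proof.
apply/null_content_dominatesP => A mA muA0; apply: null_set_integral => //.
by apply: measurable_funTS; exact/measurable_EFinP.
Qed.

(** [f] is almost everywhere the Radon-Nikodym derivative of [P], as both have the same integral
    over every measurable set. *)
Lemma ge0_integral_pdf_measure (F : R -> \bar R) :
  measurable_fun [set: R] F -> (forall x, 0 <= F x)%E ->
  (\int[P]_x F x = \int[mu]_x (F x * (f x)%:E))%E.
Proof.
move=> mF F0.
rewrite -(Radon_Nikodym_SigmaFinite.change_of_variables pdf_measure_dominates)//.
have mRN : measurable_fun [set: R] (Radon_Nikodym_SigmaFinite.f P mu).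
  exact: measurable_int (Radon_Nikodym_SigmaFinite.f_integrable pdf_measure_dominates).
apply: ae_eq_integral => //.
- exact: emeasurable_funM.
- by apply: emeasurable_funM => //; exact/measurable_EFinP.
- apply: ae_eqe_mul2l; apply: integral_ae_eq => //.
  + exact: (Radon_Nikodym_SigmaFinite.f_integrable pdf_measure_dominates).
  + exact/measurable_EFinP.
  + move=> A _ mA; rewrite -Radon_Nikodym_SigmaFinite.f_integral//.
    exact: pdf_measure_dominates.
Qed.

Lemma integral_pdf_measure (h : R -> R) : measurable_fun [set: R] h ->
  mu.-integrable [set: R] (fun x => (f x * h x)%:E) ->
  (P.-integrable [set: R] (EFin \o h)) *
  (\int[P]_x (h x)%:E = \int[mu]_x (f x * h x)%:E)%E.
Proof.
move=> mh ih; have ih' : P.-integrable [set: R] (EFin \o h).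
  apply/integrableP; split; first exact/measurable_EFinP.
  rewrite ge0_integral_pdf_measure//; last first.
    by apply: measurableT_comp => //; exact/measurable_EFinP.
  move/integrableP : ih => [_]; congr (_ < _)%E; apply: eq_integral => x _.
  by rewrite /= normrM (ger0_norm (f_ge0 x)) mulrC EFinM.
split => //.
rewrite -(Radon_Nikodym_change_of_variables pdf_measure_dominates)//.
have iRN := @Radon_Nikodym_integrable _ _ _ (charge_of_finite_measure P) mu
  pdf_measure_dominates.
apply: ae_eq_integral => //.
- apply: emeasurable_funM; first exact: measurable_int ih'.
  exact: measurable_int iRN.
- exact: measurable_int ih.
- under [X in ae_eq _ _ _ X]eq_fun do rewrite mulrC EFinM.
  apply: ae_eqe_mul2l; apply: integral_ae_eq => //.
  + exact/measurable_EFinP.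
  + move=> A _ mA; rewrite -Radon_Nikodym_integral//.
    exact: pdf_measure_dominates.
Qed.

Let idTR : measurableTypeR R -> R := idfun.

#[local] HB.instance Definition _ :=
  @isMeasurableFun.Build _ _ _ _ idTR (@measurable_id _ _ setT).

(* [pdf_measure] lives on [measurableTypeR R], the carrier of the Lebesgue
   measure; this is its copy on the canonical measurable structure of [R]. *)
Definition pdf_prob : probability R R := distribution P idTR.

Lemma ge0_integral_pdf_prob (F : R -> \bar R) :
  measurable_fun [set: R] F -> (forall x, 0 <= F x)%E ->
  (\int[pdf_prob]_x F x = \int[mu]_x (F x * (f x)%:E))%E.
Proof.
by move=> mF F0; rewrite ge0_integral_distribution//= ge0_integral_pdf_measure.
Qed.

Lemma integrable_pdf_prob (h : R -> R) : measurable_fun [set: R] h ->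
  mu.-integrable [set: R] (fun x => (f x * h x)%:E) ->
  (pdf_prob).-integrable [set: R] (EFin \o h).
Proof.
move=> mh /(integral_pdf_measure mh)[ih _].
apply/integrableP; split; first exact/measurable_EFinP.
rewrite ge0_integral_distribution//=; first by case/integrableP : ih.
by apply/measurable_EFinP; exact: measurableT_comp.
Qed.

Lemma integral_pdf_prob (h : R -> R) : measurable_fun [set: R] h ->
  mu.-integrable [set: R] (fun x => (f x * h x)%:E) ->
  (\int[pdf_prob]_x (h x)%:E = \int[mu]_x (f x * h x)%:E)%E.
Proof.
move=> mh /(integral_pdf_measure mh)[ih <-].
rewrite /pdf_prob integral_distribution//.
exact/measurable_EFinP.
Qed.

Lemma pdf_prob_le0 : pdf_prob (f @^-1` `]-oo, 0]) = 0%E.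
Proof.
apply: integral0_eq => x /=; rewrite in_itv/= => fx.
by congr (_%:E); apply/eqP; rewrite eq_le fx f_ge0.
Qed.

End DensityProbability.

(** * Translation invariance of the Lebesgue measure *)

Section Translation.
Context (R : realType) (s : R).
Local Notation mu := (@lebesgue_measure R).
Let shift : measurableTypeR R -> measurableTypeR R := fun x => x + s.

Let measurable_shift : measurable_fun [set: R] shift.
Proof. by apply: measurable_funD => //; exact: measurable_cst. Qed.

Lemma lebesgue_measureD (A : set R) : measurable A -> pushforward mu shift A = mu A.
Proof.
move=> mA; apply/esym/lebesgue_measure_unique => //= _ [[a b]] _ <-.
rewrite /pushforward (_ : _ @^-1` _ = `]a - s, b - s]%classic); last first.
  by apply/seteqP; split => x /=; rewrite !in_itv/= ltrBlDr lerBrDr.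
rewrite !lebesgue_measure_itv/= !lte_fin ltrD2r; case: ifP => // _.
by rewrite -!EFinB; congr (_%:E); ring.
Qed.

Lemma ge0_integral_shift (F : R -> \bar R) :
  measurable_fun [set: R] F -> (forall x, 0 <= F x)%E ->
  (\int[mu]_x F (x + s)%R = \int[mu]_x F x)%E.
Proof.
move=> mF F0.
rewrite -(@ge0_integral_pushforward _ _ _ _ _ shift measurable_shift mu setT F)//.
by apply: eq_measure_integral => A mA _; exact: lebesgue_measureD.
Qed.

End Translation.

(** * A variational lower bound for the divergence *)

Section KLLowerBound.
Context d (T : measurableType d) (R : realType).

(** Positive and negative parts are compared separately, which allows [f] to have an infinite
    integral; it will be a log-density. *)
Lemma ae_le_integral_integrable (mu : {measure set T -> \bar R}) (g f : T -> \bar R) :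
  mu.-integrable [set: T] g -> measurable_fun [set: T] f ->
  {ae mu, forall x, (g x <= f x)%E} -> (\int[mu]_x g x <= \int[mu]_x f x)%E.
Proof.
move=> ig mf gf; have mg := measurable_int _ ig.
rewrite integralE [leRHS]integralE; apply: leeB; apply: ae_ge0_le_integral => //.
- exact: measurable_funepos.
- exact: measurable_funepos.
- apply: filterS gf => x gfx _.
  by rewrite !funeposE ge_max !le_max gfx lexx orbT.
- exact: measurable_funeneg.
- exact: measurable_funeneg.
- apply: filterS gf => x gfx _.
  by rewrite !funenegE ge_max !le_max leeN2 gfx lexx orbT.
Qed.

Lemma measurable_inv_ge0 (g : T -> R) : (forall x, 0 <= g x) ->
  measurable_fun [set: T] g -> measurable_fun [set: T] (fun x => (g x)^-1).
Proof.
move=> g0 mg; rewrite (_ : (fun x => _) = fun x => g x `^ (-1)).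
  exact: (measurableT_comp (@measurable_powR R (-1)) mg).
by apply/funext => x; rewrite powR_inv1.
Qed.

Lemma ln2_gt0 : 0 < ln 2 :> R.
Proof. by rewrite ln_gt0// ltr1n. Qed.

Lemma measurable_log2e_comp (r : T -> \bar R) :
  (forall x, r x \is a fin_num) -> measurable_fun [set: T] r ->
  measurable_fun [set: T] (fun x => log2e (r x)).
Proof.
move=> rfin mr; have mfr : measurable_fun [set: T] (fine \o r).
  exact: measurableT_comp.
apply: emeasurable_funM; first exact: measurable_cst.
rewrite (_ : (fun x => lne (r x)) = fun x =>
    if (fine (r x) <= 0)%R then -oo%E else (ln (fine (r x)))%:E); last first.
  by apply/funext => x; rewrite -{1}(fineK (rfin x)).
apply: measurable_fun_ifT.
- by apply: measurable_fun_ler => //; exact: measurable_cst.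
- exact: measurable_cst.
- by apply/measurable_EFinP; apply: measurableT_comp mfr; exact: measurable_ln.
Qed.

(* With r the density of P with respect to Q, the hypotheses give
   ln r >= ln u + 1 - u / r, and the P-integral of u / r is at most the
   Q-integral of u. *)
Lemma kl_divergence_ge (P Q : probability T R) (u G : T -> R) :
  measurable_fun [set: T] u -> (forall x, 0 <= u x) ->
  (\int[Q]_x (u x)%:E <= 1)%E ->
  P.-integrable [set: T] (EFin \o G) ->
  {ae P, forall x, 0 < u x /\ G x <= ln (u x)} ->
  ((ln 2)^-1%:E * \int[P]_x (G x)%:E <= kl_divergence P Q)%E.
Proof.
move=> mu u0 intu iG uG; rewrite /kl_divergence.
case: asboolP => [PQ|_]; last exact: leey.
set r := Radon_Nikodym _ _.
have rfin x : r x \is a fin_num by exact: Radon_Nikodym_fin_num.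
have mr : measurable_fun [set: T] r.
  exact: measurable_int (@Radon_Nikodym_integrable _ _ _ (charge_of_finite_measure P) Q PQ).
(* This version of the density is nonnegative everywhere, and it agrees with [r] outside a [P]-null
   set. *)
pose r0 := Radon_Nikodym_SigmaFinite.f P Q.
have r0_ge0 x : (0 <= r0 x)%E by exact: Radon_Nikodym_SigmaFinite.f_ge0.
have r0fin x : r0 x \is a fin_num by exact: Radon_Nikodym_SigmaFinite.f_fin_num.
have mr0 : measurable_fun [set: T] r0.
  exact: measurable_int (Radon_Nikodym_SigmaFinite.f_integrable PQ).
have rr0 : ae_eq P [set: T] r0 r.
  apply: (null_dominates_ae_eq _ PQ) => //.
  exact: ae_eq_Radon_Nikodym_SigmaFinite.
have r0_gt0 : {ae P, forall x, 0 < fine (r0 x)}.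
  (* The [P]-mass of the zero set of [r0] is the [Q]-integral of [r0] over that set, hence 0. *)
  exists (r0 @^-1` [set 0%E]); split.
  - by rewrite -[X in measurable X]setTI; exact: mr0.
  - rewrite (Radon_Nikodym_SigmaFinite.f_integral PQ); last first.
      by rewrite -[X in measurable X]setTI; exact: mr0.
    by apply: integral0_eq => x /=.
  - move=> x /= /negP; rewrite -leNgt => r0x.
    apply/eqP; rewrite eq_le r0_ge0 andbT -(fineK (r0fin x)) lee_fin//.
have mfr0 : measurable_fun [set: T] (fine \o r0) by exact: measurableT_comp.
pose h x := u x / fine (r0 x).
have h0 x : 0 <= h x by rewrite divr_ge0// fine_ge0.
have mh : measurable_fun [set: T] h.
  apply: measurable_funM => //.
  by apply: (measurable_inv_ge0 _ mfr0) => x; rewrite fine_ge0.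
have inth : (\int[P]_x (h x)%:E <= 1)%E.
  rewrite -(Radon_Nikodym_SigmaFinite.change_of_variables PQ)//; last exact/measurable_EFinP.
  apply: le_trans intu; apply: ge0_le_integral => //.
  - by move=> x _; rewrite mule_ge0// lee_fin.
  - by apply: emeasurable_funM => //; exact/measurable_EFinP.
  - exact/measurable_EFinP.
  - move=> x _; rewrite -/(r0 x) -(fineK (r0fin x)) -EFinM lee_fin /h.
    (* Where [r0] vanishes, [h * r0] is 0 instead of [u]; hence only an inequality between the
       integrals. *)
    have [->|nz] := eqVneq (fine (r0 x)) 0; first by rewrite mulr0.
    by rewrite divfK.
have ih : P.-integrable [set: T] (EFin \o h).
  apply/integrableP; split; first exact/measurable_EFinP.
  under eq_integral => x _ do rewrite /= ger0_norm//.
  exact: le_lt_trans inth (ltry _).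
have i1 : P.-integrable [set: T] (EFin \o cst 1).
  exact: finite_measure_integrable_cst.
(* The minorant [G] stands in for [ln u], which need not be integrable. *)
pose k x := (ln 2)^-1 * (G x + (1 - h x)).
have i1h : P.-integrable [set: T] (fun x => (1 - h x)%:E).
  exact: (integrableB measurableT i1 ih).
have iG1h : P.-integrable [set: T] (fun x => (G x + (1 - h x))%:E).
  exact: (integrableD measurableT iG i1h).
have ik : P.-integrable [set: T] (EFin \o k).
  exact: (integrableZl measurableT _ iG1h).
apply: (@le_trans _ _ (\int[P]_x (k x)%:E)%E).
  under [leRHS]eq_integral do rewrite /k EFinM.
  rewrite integralZl//; apply: lee_wpmul2l.
    by rewrite lee_fin invr_ge0 ltW// ln2_gt0.
  under [leRHS]eq_integral do rewrite EFinD.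
  rewrite integralD// leeDl//.
  under eq_integral do rewrite EFinB.
  rewrite integralB// integral_cst//= mul1e probability_setT.
  by rewrite sube_ge0// orbT.
apply: ae_le_integral_integrable => //; first exact: measurable_log2e_comp.
near=> x.
have [ux Gx] : 0 < u x /\ G x <= ln (u x) by near: x.
have r0x : 0 < fine (r0 x) by near: x.
have r0rx : r0 x = r x.
  have : [set: T] x -> r0 x = r x by near: x.
  exact.
rewrite -r0rx /log2e -[in leRHS](fineK (r0fin x)) lne_EFin// -EFinM lee_fin.
rewrite /k; apply: ler_wpM2l; first by rewrite invr_ge0 ltW// ln2_gt0.
have hx : 0 < h x by rewrite divr_gt0.
(* This is [ln h <= h - 1] for [h = u / r0], that is, [ln u - ln r0 <= h - 1]. *)
have := le_ln1Dx (x := h x - 1); rewrite ltrBrDr addNr addrC subrK => /(_ hx).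
rewrite {1}/h ln_div ?posrE//; move: (ln (u x)) (ln (fine (r0 x))) (h x) Gx.
by move=> a b c ? ?; lra.
Unshelve. all: by end_near.
Qed.

End KLLowerBound.

(** * Marginals and image laws *)

Section ProductMarginals.
Context d1 d2 (T1 : measurableType d1) (T2 : measurableType d2) (R : realType).
Variables (P1 : probability T1 R) (P2 : probability T2 R).

Lemma product_probability_fst (B : set T1) : measurable B ->
  (P1 \x P2)%E (fst @^-1` B) = P1 B.
Proof.
move=> mB; rewrite (_ : fst @^-1` B = B `*` setT); last by rewrite setXT.
by rewrite product_measure1E// -[LHS]/(P1 B * P2 setT)%E probability_setT mule1.
Qed.

Lemma product_probability_snd (B : set T2) : measurable B ->
  (P1 \x P2)%E (snd @^-1` B) = P2 B.
Proof.
move=> mB; rewrite (_ : snd @^-1` B = setT `*` B); last by rewrite setTX.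
by rewrite product_measure1E// -[LHS]/(P1 setT * P2 B)%E probability_setT mul1e.
Qed.

End ProductMarginals.

(** The negligible set must live in the target space; measurability of [h] makes the set where [h]
    is nonpositive a valid choice. *)
Lemma ae_distribution d d' (T : measurableType d) (T' : measurableType d')
    (R : realType) (P : probability T R) (Z : {mfun T >-> T'}) (h : T' -> R) :
  measurable_fun [set: T'] h -> {ae P, forall w, 0 < h (Z w)} ->
  {ae distribution P Z, forall t, 0 < h t}.
Proof.
move=> mh [B [mB PB sB]]; exists (h @^-1` `]-oo, 0]); split.
- by rewrite -[X in measurable X]setTI; exact: mh.
- apply/eqP; rewrite -measure_le0 -PB.
  have mhZ : measurable_fun [set: T] (h \o Z) by exact: measurableT_comp.
  apply: (@le_measure _ _ _ P); rewrite ?inE//.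
    by rewrite -[X in measurable X]setTI; exact: mhZ.
  by move=> w /=; rewrite in_itv/= => hw; apply: sB => /=; apply/negP; rewrite -leNgt.
- by move=> t /= /negP; rewrite -leNgt in_itv.
Qed.

Lemma integral_transport d d' (T : measurableType d) (T' : measurableType d')
    (R : realType) (P : probability T R) (Q : probability T' R)
    (Z : {mfun T >-> T'}) (h : T' -> R) :
  (forall B, measurable B -> P (Z @^-1` B) = Q B) ->
  Q.-integrable [set: T'] (EFin \o h) ->
  P.-integrable [set: T] (fun w => (h (Z w))%:E) *
  (\int[P]_w (h (Z w))%:E = \int[Q]_t (h t)%:E)%E.
Proof.
move=> PQ ih; have mh := measurable_int _ ih.
have eqPQ (F : T' -> \bar R) : (\int[distribution P Z]_t F t = \int[Q]_t F t)%E.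
  by apply: eq_measure_integral => B mB _; exact: PQ.
have ihZ : P.-integrable [set: T] (fun w => (h (Z w))%:E).
  apply/integrableP; split; first exact: (measurableT_comp mh).
  rewrite -(ge0_integral_distribution Z (f := fun t => `|(h t)%:E|%E))//.
    by rewrite eqPQ; case/integrableP : ih.
  exact: measurableT_comp.
by split => //; rewrite -eqPQ integral_distribution.
Qed.

Lemma integrable_distribution d d' (T : measurableType d) (T' : measurableType d')
    (R : realType) (P : probability T R) (Z : {mfun T >-> T'}) (h : T' -> R) :
  measurable_fun [set: T'] h -> P.-integrable [set: T] (fun w => (h (Z w))%:E) ->
  (distribution P Z).-integrable [set: T'] (EFin \o h).
Proof.
move=> mh ih; apply/integrableP; split; first exact/measurable_EFinP.
rewrite ge0_integral_distribution//=; first by case/integrableP : ih.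
by apply/measurable_EFinP; exact: measurableT_comp.
Qed.

(** * The channel driven by uniform random signs *)

Section BpskChannel.
Context (R : realType) (m n : nat) (f : R -> R) (pdf_f : is_pdf f) (gamma : R)
  (A : 'M[R]_(m, n)).

Let f_ge0 x : 0 <= f x. Proof. by case: pdf_f. Qed.
Let measurable_f : measurable_fun [set: R] f. Proof. by case: pdf_f. Qed.

Definition signal (x : n.-tuple R) (i : 'I_m) : R :=
  ((Num.sqrt m%:R)^-1 *: (A *m \col_j tnth x j)) i 0.

Lemma signalE x i :
  signal x i = (Num.sqrt m%:R)^-1 * \sum_j A i j * tnth x j.
Proof. by rewrite /signal !mxE; congr (_ * _); apply: eq_bigr => j _; rewrite mxE. Qed.

Lemma measurable_signal i : measurable_fun [set: n.-tuple R] (signal ^~ i).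
Proof.
rewrite (_ : signal ^~ i = fun x => (Num.sqrt m%:R)^-1 * \sum_j A i j * tnth x j); last first.
  by apply/funext => x; rewrite signalE.
apply: measurable_funM => //; apply: measurable_sum => j.
by apply: measurable_funM => //; exact: measurable_tnth.
Qed.

Definition bpsk (b : n.-tuple bool) : n.-tuple R :=
  [tuple sgn_bool R (tnth b j) | j < n].

Lemma measurable_bpsk : measurable_fun [set: n.-tuple bool] bpsk.
Proof.
apply/measurable_fun_tnthP => j.
rewrite (_ : _ \o _ = fun b : n.-tuple bool => sgn_bool R (tnth b j)); last first.
  by apply/funext => b /=; rewrite tnth_mktuple.
apply: (measurableT_comp (f := sgn_bool R)) => //.
exact: measurable_tnth.
Qed.

(** A concrete sample space of [n] fair bits and [m] noise samples: input and noise depend on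
    different factors, which gives their independence. *)
Definition source_noise : probability (n.-tuple bool * m.-tuple R)%type R :=
  (power_probability (bernoulli_prob 2^-1) n \x
   power_probability (pdf_prob pdf_f) m)%E.
Local Notation P := source_noise.

Definition channel_input (w : n.-tuple bool * m.-tuple R) : n.-tuple R := bpsk w.1.
Definition channel_noise (w : n.-tuple bool * m.-tuple R) : m.-tuple R := w.2.
Definition channel_output (w : n.-tuple bool * m.-tuple R) : m.-tuple R :=
  cdma_output A (channel_input w) (channel_noise w).

Fact measurable_channel_input :
  measurable_fun [set: n.-tuple bool * m.-tuple R] channel_input.
Proof. by apply: measurableT_comp; [exact: measurable_bpsk|exact: measurable_fst]. Qed.

Fact measurable_channel_noise :
  measurable_fun [set: n.-tuple bool * m.-tuple R] channel_noise.
Proof. exact: measurable_snd. Qed.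

Lemma tnth_cdma_output x z i : tnth (cdma_output A x z) i = signal x i + tnth z i.
Proof. by rewrite tnth_mktuple. Qed.

Fact measurable_channel_output :
  measurable_fun [set: n.-tuple bool * m.-tuple R] channel_output.
Proof.
apply/measurable_fun_tnthP => i.
rewrite (_ : _ \o _ = fun w => signal (channel_input w) i + tnth (channel_noise w) i); last first.
  by apply/funext => w; exact: tnth_cdma_output.
apply: measurable_funD.
- by apply: (measurableT_comp (measurable_signal i)); exact: measurable_channel_input.
- by apply: (measurableT_comp (measurable_tnth i)); exact: measurable_channel_noise.
Qed.

HB.instance Definition _ :=
  @isMeasurableFun.Build _ _ _ _ channel_input measurable_channel_input.
HB.instance Definition _ :=
  @isMeasurableFun.Build _ _ _ _ channel_noise measurable_channel_noise.
HB.instance Definition _ :=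
  @isMeasurableFun.Build _ _ _ _ channel_output measurable_channel_output.

Definition input_rv : {RV P >-> n.-tuple R} := channel_input.
Definition noise_rv : {RV P >-> m.-tuple R} := channel_noise.
Definition output_rv : {RV P >-> m.-tuple R} := channel_output.

Let measurable_preimage_tnth d (U : measurableType d) k (i : 'I_k) (B : set U) :
  measurable B -> measurable ((fun t : k.-tuple U => tnth t i) @^-1` B).
Proof. by move=> mB; rewrite -[X in measurable X]setTI; exact: measurable_tnth. Qed.

Lemma source_noise_tnth i (B : set R) : measurable B ->
  P ((fun w => tnth (channel_noise w) i) @^-1` B) = pdf_prob pdf_f B.
Proof.
move=> mB; rewrite -(power_probability_tnth (pdf_prob pdf_f) i mB).
exact: product_probability_snd (measurable_preimage_tnth i mB).
Qed.

Lemma cdma_channel_bpsk : cdma_channel A f input_rv noise_rv output_rv.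
Proof.
split => //=.
- move=> w j; rewrite tnth_mktuple /sgn_bool; case: (tnth _ _).
    by right; rewrite expr1.
  by left; rewrite expr0.
- by move=> i B mB; exact: source_noise_tnth.
- move=> J B mB; under [RHS]eq_bigr => i _ do rewrite source_noise_tnth//.
  rewrite -power_probability_bigcap//; apply: product_probability_snd.
  by apply: fin_bigcap_measurable => // i _; exact: measurable_preimage_tnth.
- move=> C D mC mD.
  have mC' : measurable (bpsk @^-1` C).
    by rewrite -[X in measurable X]setTI; exact: measurable_bpsk.
  rewrite (_ : _ `&` _ = (bpsk @^-1` C) `*` D)//.
  rewrite [LHS]product_measure1E//; congr (_ * _)%E; apply/esym.
    exact: product_probability_fst.
  exact: product_probability_snd.
Qed.

Lemma independent_bpsk : mutually_independent P (fun j w => tnth (input_rv w) j).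
Proof.
move=> J B mB.
pose B' j := sgn_bool R @^-1` B j.
have mB' j : measurable (B' j) by [].
have E j : (fun w => tnth (input_rv w) j) @^-1` B j =
    fst @^-1` ((fun t : n.-tuple bool => tnth t j) @^-1` B' j).
  by apply/seteqP; split => w /=; rewrite tnth_mktuple.
have PE j : P ((fun w => tnth (input_rv w) j) @^-1` B j) = bernoulli_prob 2^-1 (B' j).
  rewrite E -(power_probability_tnth (bernoulli_prob 2^-1) j (mB' j)).
  exact: product_probability_fst (measurable_preimage_tnth j (mB' j)).
under [RHS]eq_bigr => j _ do rewrite PE.
rewrite -power_probability_bigcap//.
rewrite (_ : \bigcap_(i in _) _ = fst @^-1` (\bigcap_(j in [set` J])
    ((fun t : n.-tuple bool => tnth t j) @^-1` B' j))).
  apply: product_probability_fst.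
  by apply: fin_bigcap_measurable => // i _; exact: measurable_preimage_tnth.
by rewrite preimage_bigcap; apply: eq_bigcapr => j _; exact: E.
Qed.

(** For [gamma = 1] this is the true conditional density of the output; other exponents give a
    tempered, mismatched one. *)
Definition likelihood (x : n.-tuple R) (y : m.-tuple R) : R :=
  \prod_i f (tnth y i - signal x i) `^ gamma.

Definition mean_likelihood (y : m.-tuple R) : R :=
  (2 ^+ n)^-1 * \sum_b likelihood (bpsk b) y.

Lemma likelihood_ge0 x y : 0 <= likelihood x y.
Proof. by apply: prodr_ge0 => i _; exact: powR_ge0. Qed.

Lemma mean_likelihood_ge0 y : 0 <= mean_likelihood y.
Proof.
by rewrite mulr_ge0 ?invr_ge0 ?exprn_ge0// sumr_ge0// => b _; exact: likelihood_ge0.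
Qed.

Lemma measurable_likelihood :
  measurable_fun [set: n.-tuple R * m.-tuple R] (fun p => likelihood p.1 p.2).
Proof.
apply: measurable_prod => i _.
have mres : measurable_fun [set: n.-tuple R * m.-tuple R]
    (fun p => tnth p.2 i - signal p.1 i).
  apply: measurable_funB.
    exact: (measurableT_comp (measurable_tnth i) measurable_snd).
  exact: (measurableT_comp (measurable_signal i) measurable_fst).
exact: (measurableT_comp (@measurable_powR R gamma) (measurableT_comp measurable_f mres)).
Qed.

Lemma measurable_likelihoodr x : measurable_fun [set: m.-tuple R] (likelihood x).
Proof. exact: (measurableT_comp measurable_likelihood (pair1_measurable x)). Qed.

Lemma measurable_mean_likelihood : measurable_fun [set: m.-tuple R] mean_likelihood.
Proof.
apply: measurable_funM; first exact: measurable_cst.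
by apply: measurable_sum => b; exact: measurable_likelihoodr.
Qed.

Lemma likelihood_output b w :
  likelihood (bpsk b) (channel_output w) =
  \prod_i f (tnth w.2 i + (signal (bpsk w.1) i - signal (bpsk b) i)) `^ gamma.
Proof.
apply: eq_bigr => i _; congr (f _ `^ _).
by rewrite tnth_cdma_output addrAC addrC.
Qed.

End BpskChannel.

Lemma ln_prod (R : realType) (I : finType) (F : I -> R) :
  (forall i, 0 < F i) -> ln (\prod_i F i) = \sum_i ln (F i).
Proof.
move=> F0; suff [] : 0 < \prod_i F i /\ ln (\prod_i F i) = \sum_i ln (F i) by [].
elim/big_rec2 : _ => [|i x y _ [y0 yx]]; first by rewrite ln1.
by rewrite mulr_gt0// lnM ?posrE// yx.
Qed.

(** A named coordinate map can carry the measurable-function structure that [integral_transport]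
    asks for. *)
Definition noise_tnth (R : realType) (m n : nat) (i : 'I_m)
  (w : n.-tuple bool * m.-tuple R) : R := tnth w.2 i.

Fact measurable_noise_tnth (R : realType) (m n : nat) (i : 'I_m) :
  measurable_fun [set: n.-tuple bool * m.-tuple R] (noise_tnth i).
Proof. exact: (measurableT_comp (measurable_tnth i) measurable_snd). Qed.

HB.instance Definition _ (R : realType) (m n : nat) (i : 'I_m) :=
  @isMeasurableFun.Build _ _ _ _ (noise_tnth i) (@measurable_noise_tnth R m n i).

(** * Lower bound on the capacity of a fixed matrix *)

Section CapacityLowerBound.
Context (R : realType) (m n : nat) (f : R -> R) (pdf_f : is_pdf f) (gamma : R)
  (A : 'M[R]_(m, n)).

Local Notation P := (source_noise m n pdf_f).
Local Notation X := (input_rv m n pdf_f).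
Local Notation Y := (output_rv pdf_f A).
Local Notation L := (likelihood f gamma A).
Local Notation M := (mean_likelihood f gamma A).
Local Notation mu := (@lebesgue_measure R).

Let f_ge0 x : 0 <= f x. Proof. by case: pdf_f. Qed.
Let measurable_f : measurable_fun [set: R] f. Proof. by case: pdf_f. Qed.
Let measurable_L := measurable_likelihood pdf_f gamma A.
Let measurable_Lr := measurable_likelihoodr pdf_f gamma A.
Let measurable_M := measurable_mean_likelihood pdf_f gamma A.

Let measurable_posterior : measurable_fun [set: n.-tuple R * m.-tuple R]
  (fun p => L p.1 p.2 / M p.2).
Proof.
apply: measurable_funM => //; apply: measurable_inv_ge0.
  by move=> p; exact: mean_likelihood_ge0.
exact: (measurableT_comp measurable_M measurable_snd).
Qed.

Let posterior_ge0 x y : 0 <= L x y / M y.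
Proof. by rewrite divr_ge0 ?likelihood_ge0 ?mean_likelihood_ge0. Qed.

(** [M y] is the mean of [L x y] over the uniform inputs, so for each [y] the ratio has mean 1 in
    [x], whatever the law of [Y]. *)
Lemma integral_posterior_le1 :
  (\int[distribution P X \x distribution P Y]_p (L p.1 p.2 / M p.2)%:E <= 1)%E.
Proof.
rewrite fubini_tonelli2 //=; last 2 first.
- exact/measurable_EFinP.
- by move=> p; rewrite lee_fin.
have inner y : (\int[distribution P X]_x (L x y / M y)%:E <= 1)%E.
  have mLy : measurable_fun [set: n.-tuple R] (fun x => L x y / M y).
    exact: (measurableT_comp measurable_posterior (pair2_measurable y)).
  have mLyb : measurable_fun [set: n.-tuple bool] (fun b => L (bpsk R b) y / M y).
    exact: (measurableT_comp mLy (@measurable_bpsk R n)).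
  rewrite ge0_integral_distribution//=; last 2 first.
  - exact/measurable_EFinP.
  - by move=> x; rewrite lee_fin.
  rewrite /source_noise fubini_tonelli1 //=; last 2 first.
  - by apply/measurable_EFinP; exact: (measurableT_comp mLyb measurable_fst).
  - by move=> w; rewrite lee_fin.
  under eq_integral => b _.
    rewrite /fubini_F /= /channel_input /= integral_cst//= probability_setT mule1.
    over.
  rewrite ge0_integral_power_bernoulli//= -big_distrl /= mulrA -/(M y) lee_fin.
  (* Division by 0 gives 0, so the mean is 0 rather than 1 where [M] vanishes. *)
  have [->|M0] := eqVneq (M y) 0; first by rewrite mul0r.
  by rewrite divff.
apply: (@le_trans _ _ (\int[distribution P Y]_y (cst 1%E y))%E).
  apply: ge0_le_integral => //.
  - by move=> y _; apply: integral_ge0 => x _; rewrite lee_fin.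
  - apply: measurable_fun_fubini_tonelli_G; first exact/measurable_EFinP.
    by move=> p; rewrite lee_fin.
  - by move=> y _; exact: inner.
by rewrite integral_cst// mul1e; exact: probability_le1.
Qed.

(** In [g_fun] the translation sits on the density and not on its power; moving it across by
    translation invariance flips its sign. *)
Lemma integral_pdf_prob_shift (s : R) :
  (\int[pdf_prob pdf_f]_x (f (x + s) `^ gamma)%:E = g_fun f gamma (- s))%E.
Proof.
have mfs t : measurable_fun [set: R] (fun x => f (x + t)).
  by apply: (measurableT_comp measurable_f); exact: measurable_funD.
have mfg t : measurable_fun [set: R] (fun x => f (x + t) `^ gamma).
  exact: (measurableT_comp (@measurable_powR R gamma) (mfs t)).
rewrite ge0_integral_pdf_prob//; last 2 first.
- exact/measurable_EFinP.
- by move=> x; rewrite lee_fin powR_ge0.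
rewrite /g_fun -(ge0_integral_shift s (F := fun x => (f (- s + x) * f x `^ gamma)%:E)).
- by apply: eq_integral => x _; rewrite -EFinM mulrC (addrC (- s)) addrK.
- apply/measurable_EFinP; apply: measurable_funM.
    by under eq_fun do rewrite addrC; exact: mfs.
  by under eq_fun do rewrite -[X in f X]addr0; exact: mfg.
- by move=> x; rewrite lee_fin mulr_ge0// powR_ge0.
Qed.

(** By independence of the noise coordinates, the expectation of the product over rows factors. [G]
    holds the values of [g_fun] at the differences that occur, known to be finite, so that the
    result is a real number. *)
Lemma expected_mean_likelihood (G : R -> R) :
  (forall b c i, g_fun f gamma (signal A (bpsk R c) i - signal A (bpsk R b) i) =
                 (G (signal A (bpsk R c) i - signal A (bpsk R b) i))%:E) ->
  (\int[P]_w (M (channel_output A w))%:E =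
   ((2 ^+ n)^-1 * \sum_b (2 ^+ n)^-1 * \sum_c
     \prod_i G (signal A (bpsk R c) i - signal A (bpsk R b) i))%:E)%E.
Proof.
move=> gG.
have mMY : measurable_fun [set: n.-tuple bool * m.-tuple R]
    (fun w => (M (channel_output A w))%:E).
  apply/measurable_EFinP; apply: (measurableT_comp measurable_M).
  exact: measurable_channel_output.
have MY0 w : (0 <= (M (channel_output A w))%:E)%E.
  by rewrite lee_fin mean_likelihood_ge0.
rewrite /source_noise fubini_tonelli1//.
have inner b : (\int[power_probability (pdf_prob pdf_f) m]_z
      (M (channel_output A (b, z)))%:E =
    ((2 ^+ n)^-1 * \sum_c \prod_i G (signal A (bpsk R c) i - signal A (bpsk R b) i))%:E)%E.
  have mLc c : measurable_fun [set: m.-tuple R]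
      (fun z => L (bpsk R c) (channel_output A (b, z))).
    apply: (measurableT_comp (measurable_Lr (bpsk R c))).
    exact: (measurableT_comp (measurable_channel_output A) (pair1_measurable b)).
  under eq_integral => z _ do rewrite EFinM -sumEFin.
  rewrite ge0_integralZl_EFin//; last 2 first.
  - by move=> z _; apply: sume_ge0 => c _; rewrite lee_fin likelihood_ge0.
  - by apply: emeasurable_sum => c; exact/measurable_EFinP.
  rewrite ge0_integral_sum//; last 2 first.
  - by move=> c; exact/measurable_EFinP.
  - by move=> c z _; rewrite lee_fin likelihood_ge0.
  rewrite EFinM -sumEFin; congr (_ * _)%E; apply: eq_bigr => c _.
  under eq_integral => z _ do rewrite likelihood_output -prodEFin /=.
  pose s i := signal A (bpsk R b) i - signal A (bpsk R c) i.
  rewrite (ge0_integral_power_probability_prod _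
    (F := fun (i : 'I_m) (x : R) => (f (x + s i) `^ gamma)%:E)).
  - rewrite -prodEFin; apply: eq_bigr => i _.
    by rewrite integral_pdf_prob_shift /s opprB gG.
  - move=> i; apply/measurable_EFinP; apply: (measurableT_comp (@measurable_powR R gamma)).
    by apply: (measurableT_comp measurable_f); exact: measurable_funD.
  - by move=> i x; rewrite lee_fin powR_ge0.
pose F b := (2 ^+ n)^-1 * \sum_c \prod_i G (signal A (bpsk R c) i - signal A (bpsk R b) i).
have FE : fubini_F (power_probability (pdf_prob pdf_f) m)
    (fun w => (M (channel_output A w))%:E) = EFin \o F.
  by apply/funext => b; exact: inner.
rewrite FE ge0_integral_power_bernoulli//.
- apply/measurable_EFinP; rewrite -/(EFin \o F) -FE.
  exact: measurable_fun_fubini_tonelli_F.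
- move=> b; rewrite mulr_ge0 ?invr_ge0 ?exprn_ge0// sumr_ge0// => c _.
  apply: prodr_ge0 => i _; rewrite -lee_fin -gG; apply: integral_ge0 => x _.
  by rewrite lee_fin mulr_ge0// powR_ge0.
Qed.

Let log_f (x : R) := gamma * ln (f x).

Let measurable_log_f : measurable_fun [set: R] log_f.
Proof.
apply: measurable_funM; first exact: measurable_cst.
exact: (measurableT_comp (@measurable_ln R) measurable_f).
Qed.

(** For the transmitted input the likelihood is a product of powers of [f] at the noise samples,
    which almost surely avoid the zeros of [f]; the mean [M] contains this very term. Both factors
    being nonnegative, a positive product encodes positivity of each. *)
Lemma likelihood_ae_gt0 :
  {ae P, forall w, 0 < L (X w) (Y w) * M (Y w)}.
Proof.
have f_gt0 : {ae P, forall w, forall i, 0 < f (tnth w.2 i)}.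
  apply: filter_forall => i; exists (noise_tnth i @^-1` (f @^-1` `]-oo, 0])); split.
  - rewrite -[X in measurable X]setTI; apply: measurable_noise_tnth => //.
    by rewrite -[X in measurable X]setTI; exact: measurable_f.
  - rewrite -[RHS](pdf_prob_le0 pdf_f); apply: source_noise_tnth.
    by rewrite -[X in measurable X]setTI; exact: measurable_f.
  - by move=> w /= /negP; rewrite -leNgt in_itv.
apply: filterS f_gt0 => w fw.
have Lw : 0 < L (X w) (Y w).
  rewrite likelihood_output; apply: prodr_gt0 => i _.
  by rewrite subrr addr0 powR_gt0.
rewrite mulr_gt0// mulr_gt0 ?invr_gt0 ?exprn_gt0//.
apply: (lt_le_trans Lw); rewrite (bigD1 w.1)//= lerDl sumr_ge0// => b _.
exact: likelihood_ge0.
Qed.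

(** The bound is in nats before the division by [ln 2]: [l] is the mean of [gamma * ln f] at one
    noise sample. *)
Lemma sum_capacity_ge (l c : R) :
  mu.-integrable [set: R] (fun x => (f x * (gamma * ln (f x)))%:E) ->
  (\int[mu]_x (f x * (gamma * ln (f x)))%:E = l%:E)%E ->
  0 < c -> (\int[P]_w (M (channel_output A w))%:E <= c%:E)%E ->
  (((ln 2)^-1 * (m%:R * l - ln c))%:E <= sum_capacity A f)%E.
Proof.
move=> il intl c0 Mc.
pose u (p : n.-tuple R * m.-tuple R) := L p.1 p.2 / M p.2.
(* [G] is the logarithm of [u] with [ln M] replaced by its tangent at [c]. *)
pose G (p : n.-tuple R * m.-tuple R) :=
  \sum_i log_f (tnth p.2 i - signal A p.1 i) + (1 - ln c - c^-1 * M p.2).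
have mres i : measurable_fun [set: n.-tuple R * m.-tuple R]
    (fun p => tnth p.2 i - signal A p.1 i).
  apply: measurable_funB.
    exact: (measurableT_comp (measurable_tnth i) measurable_snd).
  exact: (measurableT_comp (measurable_signal A i) measurable_fst).
have mG : measurable_fun [set: n.-tuple R * m.-tuple R] G.
  apply: measurable_funD.
    by apply: measurable_sum => i; exact: (measurableT_comp measurable_log_f (mres i)).
  apply: measurable_funB; first exact: measurable_cst.
  apply: measurable_funM; first exact: measurable_cst.
  exact: (measurableT_comp measurable_M measurable_snd).
have GZ w : G (X w, Y w) =
    \sum_i log_f (noise_tnth i w) + (1 - ln c - c^-1 * M (channel_output A w)).
  congr (_ + _); apply: eq_bigr => i _; congr (log_f _).
  by rewrite /= tnth_cdma_output addrC addKr.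
have ilog := integrable_pdf_prob pdf_f measurable_log_f il.
have Elog := integral_pdf_prob pdf_f measurable_log_f il.
have noiseP i : P.-integrable [set: _] (fun w => (log_f (noise_tnth i w))%:E) /\
    (\int[P]_w (log_f (noise_tnth i w))%:E = l%:E)%E.
  have [|? ->] := integral_transport (P := P)
    (Z := noise_tnth i : {mfun (n.-tuple bool * m.-tuple R)%type >-> R}) _ ilog.
    by move=> B mB; exact: source_noise_tnth.
  by rewrite Elog.
have iM : P.-integrable [set: _] (fun w => (M (channel_output A w))%:E).
  have mMY : measurable_fun [set: n.-tuple bool * m.-tuple R]
      (fun w => M (channel_output A w)).
    exact: (measurableT_comp measurable_M (measurable_channel_output A)).
  apply/integrableP; split; first exact/measurable_EFinP.
  under eq_integral => w _ do rewrite /= ger0_norm ?mean_likelihood_ge0//.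
  exact: le_lt_trans Mc (ltry _).
have icM : P.-integrable [set: _] (fun w => (c^-1 * M (channel_output A w))%:E).
  exact: (integrableZl measurableT _ iM).
have i1 : P.-integrable [set: _] (EFin \o cst (1 - ln c)).
  exact: finite_measure_integrable_cst.
have iR : P.-integrable [set: _]
    (fun w => (1 - ln c - c^-1 * M (channel_output A w))%:E).
  exact: (integrableB measurableT i1 icM).
have iS : P.-integrable [set: _] (fun w => (\sum_i log_f (noise_tnth i w))%:E).
  under eq_fun do rewrite -sumEFin.
  by apply: integrable_sum => // i _; exact: (proj1 (noiseP i)).
have iGZ : P.-integrable [set: _] (fun w => (G (X w, Y w))%:E).
  under eq_fun do rewrite GZ.
  exact: (integrableD measurableT iS iR).
have iG := integrable_distribution (Z := rv_pair X Y) mG iGZ.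
have intG : ((m%:R * l - ln c)%:E <=
    \int[distribution P (rv_pair X Y)]_p (G p)%:E)%E.
  rewrite integral_distribution//; last exact/measurable_EFinP.
  under eq_integral => w _ do rewrite /= GZ EFinD.
  rewrite integralD// EFinD; apply: leeD.
    under eq_integral do rewrite -sumEFin.
    rewrite integral_sum//; last by move=> i; exact: (proj1 (noiseP i)).
    under eq_bigr => i _ do rewrite (proj2 (noiseP i)).
    by rewrite sumEFin sumr_const card_ord mulr_natl.
  under eq_integral do rewrite EFinB.
  rewrite integralB// integral_cst//.
  rewrite [X in (_ * X - _)%E](_ : _ = 1%E) ?mule1; last exact: probability_setT.
  under eq_integral do rewrite EFinM.
  rewrite integralZl//.
  have := integrable_fin_num measurableT iM.
  move: Mc; case: (\int[P]_w _)%E => //= e; rewrite lee_fin => ec _.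
  rewrite -EFinD lee_fin.
  (* The mean of [M / c] is at most 1 and is absorbed by the constant 1 of the tangent. *)
  have : c^-1 * e <= 1 by rewrite mulrC ler_pdivrMr// mul1r.
  by move=> ?; lra.
apply: (@le_trans _ _ (mutual_information X Y)); last first.
  apply: ereal_sup_ubound; exists _, _, P, X, (noise_rv m n pdf_f), Y; split => //.
    exact: cdma_channel_bpsk.
  exact: independent_bpsk.
apply: (@le_trans _ _ ((ln 2)^-1%:E * \int[distribution P (rv_pair X Y)]_p (G p)%:E)%E).
  by rewrite EFinM; apply: lee_wpmul2l => //; rewrite lee_fin invr_ge0 ltW// ln2_gt0.
apply: (kl_divergence_ge (u := u)) => //.
- by move=> p; exact: posterior_ge0.
- exact: integral_posterior_le1.
have mLM : measurable_fun [set: n.-tuple R * m.-tuple R] (fun p => L p.1 p.2 * M p.2).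
  by apply: measurable_funM => //; exact: (measurableT_comp measurable_M measurable_snd).
apply: filterS (ae_distribution (Z := rv_pair X Y) mLM likelihood_ae_gt0) => -[x y] /= LM.
have M0 : 0 < M y.
  rewrite lt_neqAle mean_likelihood_ge0 andbT eq_sym.
  by apply/eqP => My; move: LM; rewrite My mulr0 ltxx.
have L0 : 0 < L x y by move: LM; rewrite pmulr_lgt0.
split; first by rewrite divr_gt0.
rewrite /u /G /= ln_div ?posrE//.
have -> : ln (L x y) = \sum_i log_f (tnth y i - signal A x i).
  rewrite ln_prod => [|i]; first by apply: eq_bigr => i _; rewrite ln_powR.
  rewrite lt_neqAle powR_ge0 andbT eq_sym; apply/eqP => fi.
  by move: L0; rewrite /likelihood (bigD1 i)//= fi mul0r ltxx.
rewrite lerD2l.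
have := le_ln1Dx (x := c^-1 * M y - 1); rewrite ltrBrDr addNr addrC subrK => /(_ _).
rewrite lnM ?posrE ?invr_gt0// lnV ?posrE// mulr_gt0 ?invr_gt0// => /(_ isT).
by move=> ?; lra.
Qed.

End CapacityLowerBound.

(** * Infinite entropy and finiteness of the bound *)

(** For [r != 0], the finite positive part of [r * k] controls the part of [k] selected by the sign
    of [r]. If [k] is not integrable, the other part is infinite and the product is [-oo]. *)
Lemma integrableZ_or_ninfty d (T : measurableType d) (R : realType)
    (mu : {measure set T -> \bar R}) (r : R) (k : T -> R) :
  measurable_fun [set: T] k ->
  (\int[mu]_x ((fun x => (r * k x)%:E)^\+ x) < +oo)%E ->
  mu.-integrable [set: T] (fun x => (r * k x)%:E) /\
    (r%:E * \int[mu]_x (k x)%:E = \int[mu]_x (r * k x)%:E)%E \/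
  (r%:E * \int[mu]_x (k x)%:E = -oo)%E.
Proof.
move=> mk rkp; have mEk : measurable_fun [set: T] (EFin \o k) by exact/measurable_EFinP.
(* In the extended reals [0 * x = 0] even for infinite [x], so [r = 0] falls in the finite case. *)
have [->|r0] := eqVneq r 0.
  left; rewrite mul0e; under eq_fun do rewrite mul0r.
  by split; [exact: integrable0|rewrite integral0].
have [ik|nik] := pselect (mu.-integrable [set: T] (EFin \o k)).
  left; split; first exact: (integrableZl measurableT _ ik).
  by rewrite -integralZl.
right.
have mrk : measurable_fun [set: T] ((fun x => (r * k x)%:E)^\+)%E.
  by apply: measurable_funepos; exact/measurable_EFinP/measurable_funM.
have finite_part (s : R) (q : T -> \bar R) : 0 < s -> measurable_fun [set: T] q ->
    (forall x, 0 <= q x <= s%:E * (fun x => (r * k x)%:E)^\+ x)%E ->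
    (\int[mu]_x q x < +oo)%E.
  move=> s0 mq q0s; apply: (@le_lt_trans _ _
      (\int[mu]_x (s%:E * (fun x => (r * k x)%:E)^\+ x))%E).
    apply: ge0_le_integral => //.
    - by move=> x _; have /andP[] := q0s x.
    - exact: emeasurable_funM.
    - by move=> x _; have /andP[] := q0s x.
  by rewrite ge0_integralZl_EFin ?(ltW s0)// lte_mul_pinfty// lee_fin ltW.
have infinite_part : (\int[mu]_x (EFin \o k)^\+ x < +oo)%E ->
    (\int[mu]_x (EFin \o k)^\- x < +oo)%E -> False.
  move=> kp kn; apply: nik; apply/integrableP; split=> //.
  rewrite (eq_integral (fun x => (EFin \o k)^\+ x + (EFin \o k)^\- x)%E).
    rewrite ge0_integralD//; first exact: lte_add_pinfty.
      exact: measurable_funepos.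
    exact: measurable_funeneg.
  by move=> x _; exact: (congr1 (@^~ x) (fune_abse (EFin \o k))).
have pos0 : (0 <= \int[mu]_x (EFin \o k)^\+ x)%E by exact: integral_ge0.
have neg0 : (0 <= \int[mu]_x (EFin \o k)^\- x)%E by exact: integral_ge0.
rewrite integralE; have [r_lt0|r_gt0|r00] := ltgtP r 0.
- have kn : (\int[mu]_x (EFin \o k)^\- x < +oo)%E.
    apply: (finite_part (- r)^-1); rewrite ?invr_gt0 ?oppr_gt0//.
      exact: measurable_funeneg.
    move=> x; rewrite funeneg_ge0/= funenegE ge_max; apply/andP; split; last first.
      by rewrite mule_ge0// lee_fin invr_ge0 oppr_ge0 ltW.
    apply: (@le_trans _ _ ((- r)^-1%:E * (r * k x)%:E)%E).
      by rewrite -EFinM lee_fin mulrA invrN mulNr mulVf// mulN1r.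
    apply: lee_wpmul2l; first by rewrite lee_fin invr_ge0 oppr_ge0 ltW.
    by rewrite funeposE le_max lexx.
  move: pos0 infinite_part.
  case: (\int[mu]_x (EFin \o k)^\+ x)%E => [p||] // _ kp; first by case: (kp (ltry _) kn).
  by move: kn neg0; case: (\int[mu]_x _)%E => [q||]//= _ _; rewrite mulry ltr0_sg// mulN1e.
- have kp : (\int[mu]_x (EFin \o k)^\+ x < +oo)%E.
    apply: (finite_part r^-1); rewrite ?invr_gt0//.
      exact: measurable_funepos.
    move=> x; rewrite funepos_ge0/= funeposE ge_max; apply/andP; split; last first.
      by rewrite mule_ge0// lee_fin invr_ge0 ltW.
    apply: (@le_trans _ _ (r^-1%:E * (r * k x)%:E)%E).
      by rewrite -EFinM lee_fin mulKf.
    apply: lee_wpmul2l; first by rewrite lee_fin invr_ge0 ltW.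
    by rewrite funeposE le_max lexx.
  move: (infinite_part kp) neg0.
  case: (\int[mu]_x (EFin \o k)^\- x)%E => [p||] // kn _; first by case: (kn (ltry _)).
  by rewrite addeNy gt0_muleNy.
- by rewrite r00 eqxx in r0.
Qed.

Section EntropyIntegrability.
Context (R : realType) (f : R -> R) (pdf_f : is_pdf f) (gamma : R).
Local Notation mu := (@lebesgue_measure R).
Let f_ge0 x : 0 <= f x. Proof. by case: pdf_f. Qed.
Let measurable_f : measurable_fun [set: R] f. Proof. by case: pdf_f. Qed.

Lemma g_fun_ge0 t : (0 <= g_fun f gamma t)%E.
Proof. by apply: integral_ge0 => x _; rewrite lee_fin mulr_ge0// powR_ge0. Qed.

Let measurable_fg : measurable_fun [set: R] (fun x => f x * f x `^ gamma).
Proof.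
apply: measurable_funM => //.
exact: (measurableT_comp (@measurable_powR R gamma) measurable_f).
Qed.

(** Otherwise [f * f ^ gamma], and with it [f], would vanish almost everywhere, against total mass
    1. *)
Lemma g_fun0_gt0 : (0 < g_fun f gamma 0)%E.
Proof.
rewrite lt0e g_fun_ge0 andbT; apply/eqP => g0.
have mfg := measurable_fg.
have fg0 x : (0 <= (f x * f x `^ gamma)%:E)%E by rewrite lee_fin mulr_ge0// powR_ge0.
have fgae : ae_eq mu [set: R] (fun x => (f x * f x `^ gamma)%:E) (cst 0%E).
  apply/ae_eq_integral_abs => //; first exact/measurable_EFinP.
  rewrite -g0; apply: eq_integral => x _; rewrite gee0_abs// add0r//.
have : (\int[mu]_x (f x)%:E = \int[mu]_x (cst 0 x))%E.
  apply: ae_eq_integral => //; first exact/measurable_EFinP.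
  apply: filterS fgae => x /(_ I) /= [] /eqP.
  rewrite mulf_eq0 powR_eq0 => /orP[/eqP -> //|/andP[/eqP -> //]].
by case: pdf_f => _ _ ->; rewrite integral0 => -[] /eqP; rewrite oner_eq0.
Qed.

(** Where [f > 0], [gamma * ln f = ln (f ^ gamma) < f ^ gamma], and the integral of [f * f ^ gamma]
    is [g_fun] at 0. *)
Lemma integral_entropy_pos_lty : (g_fun f gamma 0 < +oo)%E ->
  (\int[mu]_x ((fun x => (gamma * (f x * log2 (f x)))%:E)^\+ x) < +oo)%E.
Proof.
move=> g0.
apply: (@le_lt_trans _ _ (\int[mu]_x ((ln 2)^-1%:E * (f x * f x `^ gamma)%:E))%E).
  apply: ge0_le_integral => //.
  - apply: measurable_funepos; apply/measurable_EFinP.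
    apply: measurable_funM => //; apply: measurable_funM => //.
    apply: measurable_funM => //.
    exact: (measurableT_comp (@measurable_ln R) measurable_f).
  - by apply: emeasurable_funM => //; exact/measurable_EFinP.
  - move=> x _; rewrite funeposE ge_max; apply/andP; split; last first.
      by rewrite -EFinM lee_fin !mulr_ge0// ?powR_ge0// invr_ge0 ltW// ln2_gt0.
    rewrite -EFinM lee_fin /log2.
    rewrite [leLHS](_ : _ = (ln 2)^-1 * (f x * (gamma * ln (f x)))); last by ring.
    rewrite ler_wpM2l ?invr_ge0 ?(ltW (@ln2_gt0 _))//.
    have [->|fx0] := eqVneq (f x) 0; first by rewrite !mul0r.
    have fx : 0 < f x by rewrite lt_neqAle eq_sym fx0 f_ge0.
    by rewrite ler_wpM2l// -ln_powR ltW// ln_sublinear// powR_gt0.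
rewrite ge0_integralZl_EFin//; last 3 first.
- by move=> x _; rewrite lee_fin mulr_ge0// powR_ge0.
- exact/measurable_EFinP.
- by rewrite invr_ge0 ltW// ln2_gt0.
rewrite [X in (_ * X)%E](_ : _ = g_fun f gamma 0); last first.
  by apply: eq_integral => x _; rewrite add0r.
by rewrite lte_mul_pinfty// lee_fin invr_ge0 ltW// ln2_gt0.
Qed.

End EntropyIntegrability.

Lemma fin_num_mul_gt0 (R : realDomainType) (r : R) (x : \bar R) :
  (0 < r)%R -> (0 <= x)%E -> (r%:E * x)%E \is a fin_num -> x \is a fin_num.
Proof. by case: x => // r0 _; rewrite gt0_muley// lte_fin. Qed.

Lemma fin_num_expe (R : realDomainType) (x : \bar R) n :
  (0 < n)%N -> (0 <= x)%E -> (x ^+ n)%E \is a fin_num -> x \is a fin_num.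
Proof.
by case: n x => // n [] // _ _; rewrite expeS gt0_mulye// expe_gt0.
Qed.

(** * The finite case: choice of the matrix *)

Section FiniteBound.
Context (R : realType) (m n : nat) (f : R -> R) (gamma : R).
Hypotheses (m_gt0 : (0 < m)%N) (pdf_f : is_pdf f).

Let g := g_fun f gamma.
Let t (k j : nat) : R := (4 * j%:R - 2 * k%:R) / Num.sqrt m%:R.
Let E : \bar R := (\sum_(0 <= k < n.+1) ('C(n, k)%:R)%:E *
  (\sum_(0 <= j < k.+1) ('C(k, j)%:R / 2 ^+ k)%:E * g (t k j)) ^+ m)%E.
Let S : R := \sum_(0 <= k < n.+1) 'C(n, k)%:R *
  (\sum_(0 <= j < k.+1) 'C(k, j)%:R / 2 ^+ k * fine (g (t k j))) ^+ m.

Let g_ge0 x : (0 <= g x)%E. Proof. exact: g_fun_ge0. Qed.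

Let inner_ge0 k : (0 <= \sum_(0 <= j < k.+1) ('C(k, j)%:R / 2 ^+ k)%:E * g (t k j))%E.
Proof. by apply: sume_ge0 => j _; rewrite mule_ge0// lee_fin divr_ge0// exprn_ge0. Qed.

Let term_ge0 k : (0 <= ('C(n, k)%:R)%:E *
  (\sum_(0 <= j < k.+1) ('C(k, j)%:R / 2 ^+ k)%:E * g (t k j)) ^+ m)%E.
Proof. by rewrite mule_ge0// expe_ge0. Qed.

Let E_ge0 : (0 <= E)%E.
Proof. by apply: sume_ge0 => k _. Qed.

(** All terms are nonnegative with positive coefficients, so none can be infinite; [m > 0] lets
    finiteness pass from the [m]-th power to its base. *)
Lemma g_fun_fin_num k j : (E < +oo)%E -> (j <= k <= n)%N -> g (t k j) \is a fin_num.
Proof.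
rewrite -ge0_fin_numE// => /sum_fin_numP Efin /andP[jk kn].
have := Efin k; rewrite mem_index_iota ltnS kn => /(_ isT isT).
move/fin_num_mul_gt0; rewrite ltr0n bin_gt0 kn expe_ge0// => /(_ isT isT).
move/(fin_num_expe m_gt0) => /(_ (inner_ge0 k)) /sum_fin_numP /(_ j).
rewrite mem_index_iota ltnS jk => /(_ isT isT) /fin_num_mul_gt0; apply => //.
by rewrite divr_gt0// ?exprn_gt0// ltr0n bin_gt0.
Qed.

Lemma bound_sumE : (E < +oo)%E -> E = S%:E.
Proof.
move=> Efin; rewrite /S -sumEFin; apply: eq_big_nat => k /andP[_ kn].
rewrite EFinM EFin_expe -sumEFin; congr (_ * _ ^+ _)%E.
apply: eq_big_nat => j /andP[_ jk].
by rewrite [in RHS]EFinM fineK// g_fun_fin_num// -ltnS jk -ltnS kn.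
Qed.

(** The [k = 0] term alone, [g 0 ^+ m], is positive; hence the logarithm is that of a positive
    number. *)
Lemma bound_sum_gt0 : (0 < E)%E.
Proof.
rewrite /E big_ltn//; apply: (@lt_le_trans _ _ (g 0 ^+ m)%E).
  by rewrite expe_gt0// g_fun0_gt0.
have t0 : t 0 0 = 0 by rewrite /t !mulr0 subrr mul0r.
by rewrite big_nat1 !bin0 t0 expr0 divr1 !mul1e leeDl// sume_ge0.
Qed.

Lemma signal_diffE (a : {ffun 'I_m -> {ffun 'I_n -> bool}}) (b c : n.-tuple bool) i :
  signal (sgn_matrix R a) (bpsk R b) i - signal (sgn_matrix R a) (bpsk R c) i =
  (\sum_j sgn_matrix R a i j * (sgn_bool R (tnth b j) - sgn_bool R (tnth c j))) /
    Num.sqrt m%:R.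
Proof.
rewrite !signalE -mulrBr mulrC -sumrB; congr (_ * _).
by apply: eq_bigr => j _; rewrite !tnth_mktuple mulrBr.
Qed.

Lemma cdma_capacity_ge (l : R) : (E < +oo)%E ->
  (@lebesgue_measure R).-integrable [set: R] (fun x => (f x * (gamma * ln (f x)))%:E) ->
  (\int[@lebesgue_measure R]_x (f x * (gamma * ln (f x)))%:E = l%:E)%E ->
  ((n%:R + m%:R * (l / ln 2) - ln S / ln 2)%:E <= cdma_capacity m n f)%E.
Proof.
move=> Efin il intl.
have S_gt0 : 0 < S by rewrite -lte_fin -bound_sumE// bound_sum_gt0.
have [a aS] := exists_signed_matrix m n (fun v => fine (g (v / Num.sqrt m%:R))).
set A := sgn_matrix R a.
have gG b c i : g (signal A (bpsk R b) i - signal A (bpsk R c) i) =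
    (fine (g (signal A (bpsk R b) i - signal A (bpsk R c) i)))%:E.
  rewrite fineK// signal_diffE; under eq_bigr do rewrite mxE.
  (* Each difference of signals is some [t k j], with [k] the Hamming distance of [b] and [c]. *)
  rewrite signed_rowE; apply: g_fun_fin_num => //.
  by rewrite subset_leq_card ?finset.subsetIr//= -[leqRHS]card_ord max_card.
have EM := expected_mean_likelihood pdf_f (G := fun v => fine (g v))
  (fun b c i => gG c b i).
apply: (@le_trans _ _ (sum_capacity A f)); last first.
  apply: ereal_sup_ubound; exists A => // i j.
  by rewrite mxE /sgn_bool; case: (a i j); [right; rewrite expr1|left; rewrite expr0].
(* The chosen matrix has a double sum of at most [2 ^+ n * S]; averaging over the [2 ^ (2n)] pairs
   of inputs leaves [S / 2 ^+ n], whose denominator supplies the term [n] of the bound. *)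
have c_gt0 : 0 < S / 2 ^+ n by rewrite divr_gt0// exprn_gt0.
have cap : (\int[source_noise m n pdf_f]_w
    (mean_likelihood f gamma A (channel_output A w))%:E <= (S / 2 ^+ n)%:E)%E.
  rewrite EM lee_fin.
  have -> : S / 2 ^+ n = (2 ^+ n)^-1 * ((2 ^+ n)^-1 * (2 ^+ n * S)).
    by rewrite mulKf ?expf_neq0// mulrC.
  rewrite -big_distrr /= !ler_pM2l ?invr_gt0 ?exprn_gt0//.
  (* The expectation involves differences [c - b] and the averaging lemma [b - c]; exchanging the
     sums relabels the pair. *)
  apply: le_trans aS; rewrite exchange_big /=.
  apply: ler_sum => b _; apply: ler_sum => c _.
  by under eq_bigr do rewrite signal_diffE.
apply: le_trans (sum_capacity_ge il intl c_gt0 cap).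
rewrite lee_fin ln_div ?posrE ?exprn_gt0// lnXn// -[X in _ - (_ - X)]mulr_natl.
rewrite (_ : _ - _ = (ln 2)^-1 * (m%:R * l - (ln S - n%:R * ln 2)))//.
by field; rewrite gt_eqF// ln2_gt0.
Qed.

End FiniteBound.

Theorem corollary1 (R : realType) (m n : nat) (f : R -> R) (gamma : R) :
  (0 < m)%N -> (0 < n)%N -> is_pdf f ->
  (n%:R%:E - (m%:R * gamma)%:E * diff_entropy f
     - log2e (\sum_(0 <= k < n.+1) ('C(n, k)%:R)%:E *
         (\sum_(0 <= j < k.+1) ('C(k, j)%:R / 2 ^+ k)%:E *
            g_fun f gamma ((4 * j%:R - 2 * k%:R) / Num.sqrt m%:R)%R) ^+ m)
   <= cdma_capacity m n f)%E.
Proof.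
move=> m_gt0 _ pdf_f; set E := (\sum_(0 <= k < n.+1) _)%E.
have ln2V_gt0 : 0 < (ln 2)^-1 :> R by rewrite invr_gt0 ln2_gt0.
have [Efin|] := ltP E +oo%E; last first.
  (* Since [x + -oo = -oo] even for [x = +oo], the value of the entropy is irrelevant here. *)
  rewrite leye_eq => /eqP ->; rewrite /log2e /= gt0_muley ?lte_fin//.
  by rewrite addeNy leNye.
have g0fin : (g_fun f gamma 0 < +oo)%E.
  have := g_fun_fin_num (k := 0) (j := 0) m_gt0 pdf_f Efin isT.
  by rewrite !mulr0 subrr mul0r => /fin_numPlt/andP[].
have mk : measurable_fun [set: measurableTypeR R] (fun x => f x * log2 (f x)).
  have mf : measurable_fun [set: R] f by case: pdf_f.
  apply: measurable_funM => //; apply: measurable_funM => //.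
  exact: (measurableT_comp (@measurable_ln R) mf).
rewrite /diff_entropy muleN oppeK EFinM -muleA.
have [[il ->]|->] := integrableZ_or_ninfty (T := measurableTypeR R) mk
  (integral_entropy_pos_lty pdf_f g0fin); last first.
  by rewrite gt0_muleNy ?lte_fin ?ltr0n// addeNy leNye.
(* Passing from bits to nats turns the mean [l] into [ln 2 * l]. *)
have lnE x : f x * (gamma * ln (f x)) = ln 2 * (gamma * (f x * log2 (f x))).
  by rewrite /log2; field; rewrite gt_eqF// ln2_gt0.
have := integrable_fin_num measurableT il.
case intl : (\int[_]_x _)%E => [l||] // _.
have E_gt0 : (0 < E)%E by exact: bound_sum_gt0.
have ES := bound_sumE m_gt0 pdf_f Efin; rewrite -/E in ES.
have := @cdma_capacity_ge R m n f gamma m_gt0 pdf_f (ln 2 * l) Efin.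
move: E_gt0; rewrite ES; set S := (\sum_(0 <= k < n.+1) _)%R.
rewrite lte_fin /log2e => S_gt0 cap; rewrite lne_EFin//.
apply: (le_trans _ (cap _ _)).
- rewrite -!EFinM -EFinN -!EFinD lee_fin (mulrC (ln 2)) mulfK ?gt_eqF ?ln2_gt0//.
  by rewrite [(ln 2)^-1 * _]mulrC.
- under eq_fun do rewrite lnE EFinM.
  exact: integrableZl.
- under eq_integral do rewrite lnE EFinM.
  by rewrite integralZl// intl.
Qed.
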